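(* There is a distributed algorithm that, for every graph $G$, every fragmentation $\mathcal{F}=(F,G_f)$ of $G$ with fragment graph $G_f=(V_f,E_f)$, and every bounded reachability query $q_{br}(s,t,l)$ with nodes $s,t$ of $G$ and integer bound $l$, correctly decides whether $\mathrm{dist}(s,t)\le l$ in $G$, and does so (a) in $O(|V_f|\,|F_m|)$ time, where $F_m$ is the largest fragment in $F$; (b) by visiting each site only once; and (c) with total network traffic bounded by $O(|V_f|^2)$.
   Context: **Graphs.** A graph $G=(V,E,L)$ has a finite node set $V$, directed edges $E\subseteq V\times V$, and a labeling $L:V\to\Sigma$ of the nodes by labels from a set $\Sigma$. A path from $v$ to $w$ is a node sequence $(v=v_0,v_1,\dots,v_n=w)$ with $(v_{i-1},v_i)\in E$ for all $i\in[1,n]$; its length is the number $n$ of its edges. The distance $\mathrm{dist}(v,w)$ is the length of a shortest path from $v$ to $w$ ($\infty$ if there is none). **Fragmentation.** A fragmentation of $G$ is a pair $\mathcal{F}=(F,G_f)$. Here $F=(F_1,\dots,F_k)$, and each fragment is $F_i=(V_i\cup F_i.O,\ E_i\cup cE_i,\ L_i)$, where: - $(V_1,\dots,V_k)$ is an (arbitrary) partition of $V$; - $(V_i,E_i,L_i)$ is the subgraph of $G$ induced by $V_i$; - $F_i.O$ (the virtual nodes of $F_i$) is the set of nodes $v\notin V_i$ such that $(u,v)\in E$ for some $u\in V_i$; - $cE_i$ (the cross edges) is the set of all edges $(u,v)\in E$ with $u\in V_i$ and $v\in F_i.O$. The in-nodes $F_i.I$ are the nodes $u\in V_i$ such that $(v,u)\in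 E$ for some $v$ in another $V_j$, $j\ne i$. The fragment graph is $G_f=(V_f,E_f)$ with $V_f=\bigcup_i (F_i.O\cup F_i.I)$ and $E_f=\bigcup_i cE_i$. The size $|F_i|$ is the number of nodes plus the number of edges of $F_i$, and $F_m$ is a fragment of maximum size. **Distributed model.** Fragment $F_i$ is stored at site $S_i$. A coordinator site $S_c$ receives the query and knows which fragment is at which site, as well as $G_f$. It posts the query to the sites (a site is visited each time it is contacted in this way). The sites compute locally and in parallel and ship data back to the coordinator, which computes the answer. Time means response time: the maximum over sites of the local (RAM-model) computation time, plus the computation time at the coordinator. Network traffic is the total amount of data shipped between sites, where a number (such as a distance) counts as one unit. The size of the posted query is regarded as negligible and posting it is not counted. The bounds are read with $|V_f|$ replaced by $\max(1,|V_f|)$. *)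

(* Defs.v *)
From mathcomp Require Import all_boot all_order all_algebra.

Set Implicit Arguments.
Unset Strict Implicit.
Unset Printing Implicit Defensive.

(** * Graphs and distances *)

Record graph (Sigma : Type) := Graph {
  node :> finType;
  edge : rel node;
  label : node -> Sigma
}.

Section Distance.
Variables (T : finType) (e : rel T).

Definition path_of_length (v w : T) (n : nat) : bool :=
  [exists p : n.-tuple T, path e v p && (last v p == w)].

Lemma connect_path_of_length v w :
  connect e v w -> exists n, path_of_length v w n.
Proof.
move=> /connectP[p pP ->]; exists (size p).
by apply/existsP; exists (in_tuple p); rewrite pP eqxx.
Qed.

(* [None] is the infinite distance. *)
Definition dist (v w : T) : option nat :=
  match @idP (connect e v w) with
  | ReflectT vw => Some (ex_minn (connect_path_of_length vw))
  | ReflectF _ => None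
  end.

End Distance.

Definition dist_le (d : option nat) (l : int) : bool :=
  if d is Some n then (Posz n <= l)%R else false.

(** * Fragmentations *)

(* [F i] is the node set V_i.  MathComp's [partition] excludes empty blocks. *)
Record fragmentation (Sigma : Type) (G : graph Sigma) (k : nat) :=
  Fragmentation {
    part :> 'I_k -> {set G};
    part_inj : injective part;
    part_partition : partition [set part i | i : 'I_k] [set: G]
  }.

Section Fragments.
Variables (Sigma : Type) (G : graph Sigma) (k : nat) (F : fragmentation G k).
Implicit Type i : 'I_k.

Definition inner_edges i : {set G * G} :=
  [set e : G * G | [&& edge e.1 e.2, e.1 \in F i & e.2 \in F i]].

Definition virtual_nodes i : {set G} :=
  [set v | (v \notin F i) && [exists u in F i, edge u v]].

Definition cross_edges i : {set G * G} :=
  [set e : G * G | [&& edge e.1 e.2, e.1 \in F i & e.2 \in virtual_nodes i]].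

Definition in_nodes i : {set G} :=
  [set u in F i | [exists (j | j != i), [exists v in F j, edge v u]]].

Definition frag_nodes i : {set G} := F i :|: virtual_nodes i.
Definition frag_edges i : {set G * G} := inner_edges i :|: cross_edges i.
Definition frag_size i : nat := #|frag_nodes i| + #|frag_edges i|.

Definition max_frag_size : nat := \max_(i < k) frag_size i.

Definition Vf : {set G} := \bigcup_(i < k) (virtual_nodes i :|: in_nodes i).
Definition Ef : {set G * G} := \bigcup_(i < k) cross_edges i.

End Fragments.

(** * Random access machine *)

(* Unit-cost RAM over the natural numbers, presented as a structured language:
   finitely many arrays (those named in the program text) of unbounded length,
   indirect addressing, addition and truncated subtraction.  Scalars are
   length-one arrays.  Cells not holding input are initially 0. *)

Definition memory := nat -> nat -> nat.

Inductive expr :=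
| Lit of nat
| Get of nat & expr
| Add of expr & expr
| Sub of expr & expr.

Inductive cmd :=
| Skip
| Put of nat & expr & expr  (* [Put a e1 e2] is a[e1] := e2 *)
| Seq of cmd & cmd
| If of expr & cmd & cmd
| While of expr & cmd
| Send of expr              (* appends a number to the output *)
| Post.                     (* coordinator only: posts the query to the sites *)

Fixpoint eval (m : memory) (e : expr) : nat :=
  match e with
  | Lit n => n
  | Get a e1 => m a (eval m e1)
  | Add e1 e2 => eval m e1 + eval m e2
  | Sub e1 e2 => eval m e1 - eval m e2
  end.

Fixpoint cost (e : expr) : nat :=
  match e with
  | Lit _ => 1
  | Get _ e1 => (cost e1).+1
  | Add e1 e2 | Sub e1 e2 => (cost e1 + cost e2).+1
  end.

Definition update (m : memory) (a i n : nat) : memory :=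
  fun b j => if (b == a) && (j == i) then n else m b j.

Definition load (m : memory) (a : nat) (s : seq nat) : memory :=
  fun b j => if b == a then nth 0 s j else m b j.

Definition memory_of (ss : seq (seq nat)) : memory :=
  fun a j => nth 0 (nth [::] ss a) j.

Section Exec.

(* [post w m w' m'] is the effect of [Post] on the outside world and on the
   memory. *)
Variables (world : Type) (post : world -> memory -> world -> memory -> Prop).

Record config := Config { mem : memory; out : seq nat; env : world }.

(* [exec c x T y]: started in [x], [c] halts in [y] after time [T].  Posting the
   query is not counted. *)
Inductive exec : cmd -> config -> nat -> config -> Prop :=
| ExecSkip x : exec Skip x 1 x
| ExecPut a e1 e2 m o w :
    exec (Put a e1 e2) (Config m o w) (cost e1 + cost e2).+1
      (Config (update m a (eval m e1) (eval m e2)) o w)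
| ExecSeq c1 c2 x y z T1 T2 :
    exec c1 x T1 y -> exec c2 y T2 z -> exec (Seq c1 c2) x (T1 + T2) z
| ExecIfTrue e c1 c2 x y T :
    eval (mem x) e != 0 -> exec c1 x T y ->
    exec (If e c1 c2) x (cost e + T).+1 y
| ExecIfFalse e c1 c2 x y T :
    eval (mem x) e = 0 -> exec c2 x T y ->
    exec (If e c1 c2) x (cost e + T).+1 y
| ExecWhileTrue e c x y z T1 T2 :
    eval (mem x) e != 0 -> exec c x T1 y -> exec (While e c) y T2 z ->
    exec (While e c) x ((cost e).+1 + T1 + T2) z
| ExecWhileFalse e c x :
    eval (mem x) e = 0 -> exec (While e c) x (cost e).+1 x
| ExecSend e m o w :
    exec (Send e) (Config m o w) (cost e).+1 (Config m (rcons o (eval m e)) w)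
| ExecPost m o w m' w' :
    post w m w' m' -> exec Post (Config m o w) 0 (Config m' o w').

End Exec.

(* A site cannot post: [Post] blocks. *)
Definition exec_site : cmd -> config unit -> nat -> config unit -> Prop :=
  exec (fun _ _ _ _ => False).

(** * Data held by the sites and by the coordinator *)

Section Encoding.
Variables (Sigma : Type) (G : graph Sigma).

Definition node_id (v : G) : nat := enum_rank v.
Definition ids (A : {set G}) : seq nat := [seq node_id v | v <- enum A].
Definition sources (E : {set G * G}) : seq nat :=
  [seq node_id e.1 | e <- enum E].
Definition targets (E : {set G * G}) : seq nat :=
  [seq node_id e.2 | e <- enum E].

(* The integer bound is given by its sign and absolute value. *)
Definition query_data (s t : G) (l : int) : seq nat :=
  [:: node_id s; node_id t; nat_of_bool (l < 0)%R; absz l].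

Variables (k : nat) (F : fragmentation G k).

(* Array 0 is reserved for the query.  The in-nodes belong to the data of a
   site: they cannot be computed from the rest of the fragment.  Labels play no
   role in a bounded reachability query and are withheld from the programs. *)
Definition site_data (i : 'I_k) : memory :=
  memory_of [::
    [::];
    [:: #|F i|; #|virtual_nodes F i|; #|in_nodes F i|; #|frag_edges F i|];
    ids (F i);
    ids (virtual_nodes F i);
    ids (in_nodes F i);
    sources (frag_edges F i);
    targets (frag_edges F i)].

(* Fragment [i] resides at site [i], so the placement needs no table. *)
Definition coordinator_data (s t : G) (l : int) : memory :=
  memory_of [::
    query_data s t l;
    [:: k; #|Vf F|; #|Ef F|];
    ids (Vf F);
    sources (Ef F);
    targets (Ef F)].

End Encoding.

(** * Distributed algorithms *)

(* One program run by every site, and one run by the coordinator. *)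
Record algorithm := Algorithm { site_prog : cmd; coordinator_prog : cmd }.

Record site_state := SiteState {
  site_mem : memory;
  site_time : nat;
  site_visits : nat;
  site_shipped : seq nat
}.

Section Protocol.
Variables (Sigma : Type) (G : graph Sigma) (k : nat) (F : fragmentation G k).
Variables (A : algorithm) (s t : G) (l : int).

(* A visit: the site receives the query in array 0, runs its program on its
   (persistent) memory, and ships the output [msg].  A shipped number counts as
   one unit of traffic, so it must fit in a word: it is at most |V|, the range of
   node names and distances, so that large numbers cannot pack data. *)
Definition visit (x : site_state) (msg : seq nat) (x' : site_state) : Prop :=
  exists T y,
    [/\ exec_site (site_prog A)
          (Config (load (site_mem x) 0 (query_data s t l)) [::] tt) T y,
        msg = out y,
        all (fun n => n <= #|G|) msg &
        x' = SiteState (mem y) (site_time x + T) (site_visits x).+1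
               (site_shipped x ++ msg)].

(* Arrays 5, 6 and 7 of the coordinator: the concatenated messages, their total
   length, and the length of the message of each site. *)
Definition receive (m : memory) (msg : 'I_k -> seq nat) : memory :=
  let data := flatten [seq msg i | i <- enum 'I_k] in
  load (load (load m 5 data) 6 [:: size data])
    7 [seq size (msg i) | i <- enum 'I_k].

(* Posting the query visits every site once more. *)
Definition post_query (w : 'I_k -> site_state) (m : memory)
    (w' : 'I_k -> site_state) (m' : memory) : Prop :=
  exists msg : 'I_k -> seq nat,
    (forall i, visit (w i) (msg i) (w' i)) /\ m' = receive m msg.

Definition initial_sites (i : 'I_k) : site_state :=
  SiteState (site_data F i) 0 0 [::].

Record outcome := Outcome {
  answer : seq nat;
  coordinator_time : nat;
  sites : 'I_k -> site_state
}.

(* The algorithm terminates on this input with outcome [R]; the semantics is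
   deterministic, so there is at most one such [R]. *)
Definition terminates_with (R : outcome) : Prop :=
  exists m,
    exec post_query (coordinator_prog A)
      (Config (coordinator_data F s t l) [::] initial_sites)
      (coordinator_time R)
      (Config m (answer R) (sites R)).

Definition response_time (R : outcome) : nat :=
  \max_(i < k) site_time (sites R i) + coordinator_time R.

Definition visits (R : outcome) (i : 'I_k) : nat := site_visits (sites R i).

Definition traffic (R : outcome) : nat :=
  \sum_(i < k) size (site_shipped (sites R i)).

End Protocol.

(* Main.v *)
Require Import Defs.
From mathcomp Require Import all_boot all_order all_algebra.
From mathcomp Require Import zify.

(* Each site computes, by one search of its fragment per source, the distances
   from its in-nodes (and s) to its virtual nodes (and t), and ships them as
   triples (u, v, d).  Cutting a path from s to t where it changes fragments
   shows that dist(s, t) is the distance from s to t in the weighted graph formed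
   by all triples, which the coordinator computes.

   The in-nodes of distinct fragments are disjoint subsets of V_f, so there are at
   most (|V_f| + 1)(m + 1) triples as soon as every fragment has at most m virtual
   nodes; m = |V_f| bounds the traffic and m = |F_m| the time.  A quadratic
   Dijkstra would be too slow for the coordinator, since |V_f| may exceed |F_m|.
   But all weights are O(|F_m|), so all distances are O(|V_f| |F_m|), and Dial's
   bucket queue runs in time linear in the number of edges plus the largest
   distance.  The sites run the same search with unit weights. *)

Set Implicit Arguments.
Unset Strict Implicit.
Unset Printing Implicit Defensive.

(** * Programs and time credits *)

Lemma updateE m a i n b j :
  update m a i n b j = if (b == a) && (j == i) then n else m b j.
Proof. by []. Qed.

Definition frame (W : seq nat) (m m' : memory) : Prop :=
  forall b, b \notin W -> forall j, m' b j = m b j.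

Lemma frame_refl W m : frame W m m.
Proof. by []. Qed.

Lemma frame_trans W m1 m2 m3 :
  frame W m1 m2 -> frame W m2 m3 -> frame W m1 m3.
Proof. by move=> h1 h2 b hb j; rewrite h2 // h1. Qed.

Lemma frame_sub W W' m m' : all (mem W') W -> frame W m m' -> frame W' m m'.
Proof.
by move=> /allP sW h b hb j; apply: h; apply: contra hb => /sW.
Qed.

Lemma frame_update W m m' a i n :
  a \in W -> frame W m m' -> frame W m (update m' a i n).
Proof.
move=> aW h b hb j; rewrite updateE.
by case: eqP hb => [->|_ hb]; [rewrite aW | rewrite /= h].
Qed.

Declare Scope cmd_scope.
Delimit Scope cmd_scope with cmd.
Local Notation "c1 ;; c2" := (Seq c1 c2) (at level 90, right associativity) : cmd_scope.
Local Notation var x := (Get x (Lit 0)).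
Local Notation set_var x e := (Put x (Lit 0) e).

Section Logic.
Variables (world : Type) (post : world -> memory -> world -> memory -> Prop).
Variable w : world.

Definition assertion := nat -> memory -> seq nat -> Prop.

(* [B] is a supply of time credits; [Q] receives the unspent ones.  Since every
   evaluation of a guard spends credits, the supply also bounds the number of
   iterations, and loops need no other variant. *)
Definition wp (c : cmd) (B : nat) (Q : assertion) (m : memory) (o : seq nat) :=
  exists T m' o', [/\ exec post c (Config m o w) T (Config m' o' w),
    T <= B & Q (B - T) m' o'].

Lemma wp_skip B (Q : assertion) m o : 1 <= B -> Q (B - 1) m o -> wp Skip B Q m o.
Proof. by move=> hB hQ; exists 1, m, o; split=> //; apply: ExecSkip. Qed.

Lemma wp_put a e1 e2 B (Q : assertion) m o :
  (cost e1 + cost e2).+1 <= B ->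
  Q (B - (cost e1 + cost e2).+1) (update m a (eval m e1) (eval m e2)) o ->
  wp (Put a e1 e2) B Q m o.
Proof. by move=> hB hQ; do 3!eexists; split; [apply: ExecPut | |exact: hQ]. Qed.

Lemma wp_send e B (Q : assertion) m o :
  (cost e).+1 <= B -> Q (B - (cost e).+1) m (rcons o (eval m e)) ->
  wp (Send e) B Q m o.
Proof. by move=> hB hQ; do 3!eexists; split; [apply: ExecSend | |exact: hQ]. Qed.

Lemma wp_seq c1 c2 B (Q : assertion) m o :
  wp c1 B (fun B => wp c2 B Q) m o -> wp (Seq c1 c2) B Q m o.
Proof.
move=> [T1 [m1 [o1 [h1 l1 [T2 [m2 [o2 [h2 l2 hQ]]]]]]]].
exists (T1 + T2), m2, o2; rewrite subnDA; split=> //; last by lia.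
exact: ExecSeq h1 h2.
Qed.

Lemma wp_if e c1 c2 B (Q : assertion) m o :
  (cost e).+1 <= B ->
  (if eval m e != 0 then wp c1 (B - (cost e).+1) Q m o
   else wp c2 (B - (cost e).+1) Q m o) ->
  wp (If e c1 c2) B Q m o.
Proof.
move=> hB; case: ifPn => he [T [m' [o' [h l hQ]]]];
  exists (cost e + T).+1, m', o'; rewrite -addSn subnDA; split=> //; try lia.
- exact: ExecIfTrue.
- by apply: ExecIfFalse => //; apply/eqP; rewrite negbK in he.
Qed.

Lemma wp_while e c (Inv Q : assertion) B m o :
  (forall B m o, Inv B m o ->
     (cost e).+1 <= B /\
     if eval m e != 0 then wp c (B - (cost e).+1) Inv m o
     else Q (B - (cost e).+1) m o) ->
  Inv B m o -> wp (While e c) B Q m o.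
Proof.
move=> step; elim/ltn_ind: B m o => B IH m o /step[hB].
case: ifPn => he.
- move=> [T1 [m1 [o1 [h1 l1 /IH hI]]]].
  have /hI[T2 [m2 [o2 [h2 l2 hQ]]]] : B - (cost e).+1 - T1 < B by lia.
  exists ((cost e).+1 + T1 + T2), m2, o2; rewrite !subnDA; split=> //; last by lia.
  exact: ExecWhileTrue h1 h2.
- move=> hQ; exists (cost e).+1, m, o; split=> //.
  by apply: ExecWhileFalse; apply/eqP; rewrite negbK in he.
Qed.

(** Subprograms are specified with an upper estimate [K] of their cost. A caller with a larger
    supply learns only that at least [B - K] credits remain. *)
Lemma wp_call c K (P : memory -> seq nat -> Prop) B (Q : assertion) m o :
  wp c K (fun=> P) m o -> K <= B ->
  (forall B' m' o', B - K <= B' -> P m' o' -> Q B' m' o') ->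
  wp c B Q m o.
Proof.
move=> [T [m' [o' [h l hP]]]] hK hQ; exists T, m', o'; split=> //; first by lia.
by apply: hQ hP; lia.
Qed.

End Logic.

(** * Linked lists stored in arrays *)

Section Chain.
Variable X : Type.

(** Pointer 0 ends a list, so cells are numbered from 1. The bound [n] is the last allocated cell: a
    write to a fresh cell beyond it leaves every stored list intact. *)
Fixpoint chain (next : nat -> nat) (val : nat -> X) (n p : nat) (l : seq X) :=
  if l is x :: l' then
    [/\ 0 < p, p <= n, val p = x & chain next val n (next p) l']
  else p = 0.

Lemma chain_ext next val next' val' n n' p l :
  n <= n' ->
  (forall q, 0 < q <= n -> next' q = next q) ->
  (forall q, 0 < q <= n -> val' q = val q) ->
  chain next val n p l -> chain next' val' n' p l.
Proof.
move=> nn' hn hv; elim: l p => //= x l IH p [p0 pn vp /IH h].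
by rewrite hn ?hv ?p0 //; split=> //; apply: leq_trans nn'.
Qed.

End Chain.

(** * Edges and events in memory *)

(* Adjacency lists: [HD] maps a node to its first edge, and [NX], [TG], [WT] an
   edge to the next one, its target and its weight; [NE] counts the edges.  Bucket
   queue: [BH] maps a time to its first event, and [EN], [EV] an event to the next
   one and to its node; [CT] counts the events ever created, [PD] the pending ones.
   [DI] maps a node to the time when it was settled. *)
Local Notation HD := 10 (only parsing).
Local Notation NX := 11 (only parsing).
Local Notation TG := 12 (only parsing).
Local Notation WT := 13 (only parsing).
Local Notation NE := 14 (only parsing).
Local Notation BH := 15 (only parsing).
Local Notation EN := 16 (only parsing).
Local Notation EV := 17 (only parsing).
Local Notation CT := 18 (only parsing).
Local Notation PD := 19 (only parsing).
Local Notation DI := 20 (only parsing).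
Local Notation NOW := 21 (only parsing).
Local Notation ST := 22 (only parsing).
Local Notation U := 23 (only parsing).
Local Notation PT := 24 (only parsing).
Local Notation X1 := 25 (only parsing).
Local Notation X2 := 26 (only parsing).
Local Notation X3 := 27 (only parsing).
Local Notation J := 28 (only parsing).
Local Notation L := 29 (only parsing).

Local Notation triple := (nat * nat * nat)%type.

Definition adjacency (es : seq triple) (u : nat) : seq (nat * nat) :=
  [seq (e.1.2, e.2) | e <- es & e.1.1 == u].

(** A triple is (source, target, weight). New edges go to the front of their adjacency list, so [es]
    lists the newest edge first. *)
Definition stores_edges (m : memory) (es : seq triple) : Prop :=
  forall u, chain (m NX) (fun p => (m TG p, m WT p)) (m NE 0) (m HD u)
              (adjacency es u).

Definition add_edge (a b c : expr) : cmd :=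
  (set_var X1 a ;; set_var X2 b ;; set_var X3 c ;;
   set_var NE (Add (var NE) (Lit 1)) ;;
   Put TG (var NE) (var X2) ;; Put WT (var NE) (var X3) ;;
   Put NX (var NE) (Get HD (var X1)) ;; Put HD (var X1) (var NE))%cmd.

Definition stores_events (m : memory) (P : seq (nat * nat)) : Prop :=
  m PD 0 = size P /\
  forall t, chain (m EN) (m EV) (m CT 0) (m BH t) [seq x.1 | x <- P & x.2 == t].

Definition push (a t : expr) : cmd :=
  (set_var X1 a ;; set_var X2 t ;;
   set_var CT (Add (var CT) (Lit 1)) ;;
   Put EV (var CT) (var X1) ;; Put EN (var CT) (Get BH (var X2)) ;;
   Put BH (var X2) (var CT) ;;
   set_var PD (Add (var PD) (Lit 1)))%cmd.

Definition push_frame := [:: X1; X2; CT; EV; EN; BH; PD].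
Definition add_edge_frame := [:: X1; X2; X3; NE; TG; WT; NX; HD].

Ltac assign := apply: wp_put; [rewrite /=; lia | rewrite ?updateE /=].
Ltac seq_assign := apply: wp_seq; assign.

Section Primitives.
Variables (world : Type) (post : world -> memory -> world -> memory -> Prop).
Variable w : world.
Local Notation wp := (wp post w).

Lemma wp_push a t P m o :
  stores_events m P -> eval (update m X1 0 (eval m a)) t = eval m t ->
  wp (push a t) (50 + cost a + cost t)
    (fun=> fun m' o' => [/\ o' = o,
       stores_events m' ((eval m a, eval m t) :: P) & frame push_frame m m']) m o.
Proof.
move=> [pd bk] ht; rewrite /push; do 6 seq_assign; assign.
rewrite !ht.
set x := eval m a; set s := eval m t.
split=> //; last by repeat (apply: frame_update => //).
split; first by rewrite !updateE /= pd addn1.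
move=> r; have := bk r; rewrite !updateE /= (eq_sym s r).
case: eqP => [->|_] /= h; last first.
  apply: chain_ext h; rewrite ?leq_addr // => q; rewrite ?updateE /= => /andP[q0 qn].
    by rewrite ifN_eq //; lia.
  by rewrite ifN_eq //; lia.
rewrite !updateE /= !eqxx /=.
split=> //; rewrite ?addn1 //.
apply: chain_ext h; rewrite ?leqnSn // => q; rewrite ?updateE /= => /andP[q0 qn].
  by rewrite ifN_eq //; lia.
by rewrite ifN_eq //; lia.
Qed.

(** The arguments are copied one after another into scratch cells, so [b] and [c] are evaluated
    after [X1], and [X1] and [X2], have been overwritten; their values must survive this. *)
Lemma wp_add_edge a b c es m o x y z :
  stores_edges m es ->
  eval m a = x ->
  (forall n, eval (update m X1 0 n) b = y) ->
  (forall n n', eval (update (update m X1 0 n) X2 0 n') c = z) ->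
  wp (add_edge a b c) (60 + cost a + cost b + cost c)
    (fun=> fun m' o' => [/\ o' = o,
       stores_edges m' ((x, y, z) :: es) & frame add_edge_frame m m']) m o.
Proof.
move=> hes ea eb ec; rewrite /add_edge; do 7 seq_assign; assign.
rewrite ea !eb !ec.
split=> //; last by repeat (apply: frame_update => //).
move=> u; have := hes u; rewrite !updateE /= /adjacency /= (eq_sym x u).
case: eqP => [->|_] /= h; last first.
  apply: chain_ext h; rewrite ?leq_addr // => q; rewrite ?updateE /= => /andP[q0 qn].
    by rewrite ifN_eq //; lia.
  by rewrite !ifN_eq //; lia.
rewrite !updateE /= !eqxx /=.
split=> //; rewrite ?addn1 //.
apply: chain_ext h; rewrite ?leqnSn // => q; rewrite ?updateE /= => /andP[q0 qn].
  by rewrite ifN_eq //; lia.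
by rewrite !ifN_eq //; lia.
Qed.

End Primitives.

(** * Dial's search *)

Inductive walk (es : seq triple) (u : nat) : nat -> nat -> Prop :=
| walk_nil : walk es u u 0
| walk_rcons v x c n : walk es u v n -> (v, x, c) \in es -> walk es u x (n + c).

Lemma walk_sub es es' u v n :
  {subset es <= es'} -> walk es u v n -> walk es' u v n.
Proof.
move=> sub; elim=> [|x y c p _ IH /sub]; first exact: walk_nil.
exact: walk_rcons.
Qed.

Lemma walk_trans es u v x n p : walk es u v n -> walk es v x p -> walk es u x (n + p).
Proof.
move=> wn; elim=> [|y z c q _ IH hz]; first by rewrite addn0.
by rewrite addnA; apply: walk_rcons hz.
Qed.

Lemma walk_target es u v n : walk es u v n -> v = u \/ v \in [seq e.1.2 | e <- es].
Proof. by case=> [|x y c p _ he]; [left | right; apply: (map_f _ he)]. Qed.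

Lemma walk_no_source es u v n :
  ~~ has (fun e => e.1.1 == u) es -> walk es u v n -> v = u.
Proof.
move=> /hasPn no; elim=> // x y c p _ -> /no /=; by rewrite eqxx.
Qed.

Lemma mem_adjacency es u x c : ((x, c) \in adjacency es u) = ((u, x, c) \in es).
Proof.
apply/mapP/idP => [[[[u' x'] c']]|h]; last first.
  by exists (u, x, c); rewrite // mem_filter eqxx.
by rewrite mem_filter /= => /andP[/eqP-> h] [-> ->].
Qed.

(** * The invariant of the bucket search, independently of memory *)

Section SearchInvariant.
Variables (es : seq triple) (s tau W : nat).

(* [D] is the array of settling times, [S] lists the settled nodes, and [Q] the
   scheduled events (node, time); the clock starts at [tau] and shows [now]. *)
Record search_inv (D : nat -> nat) (now : nat) (S : seq nat)
    (Q : seq (nat * nat)) : Prop := SearchInv {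
  inv_settled : forall v, (v \in S) = (tau <= D v);
  inv_uniq : uniq S;
  inv_past : forall v, D v <= now;
  inv_sound : forall v, v \in S -> walk es s v (D v - tau);
  inv_event : forall v t, (v, t) \in Q ->
    [/\ tau <= t, now <= t, t <= tau + size S * W & walk es s v (t - tau)];
  inv_closed : forall u v c, u \in S -> (u, v, c) \in es ->
    (v \in S) && (D v <= D u + c) || ((v, D u + c) \in Q);
  inv_source : (s \in S) && (D s <= tau) || ((s, tau) \in Q);
  inv_now : tau <= now <= tau + size S * W
}.

Lemma search_inv_init D :
  (forall v, D v < tau) -> search_inv D tau [::] [:: (s, tau)].
Proof.
move=> hD; split=> //=.
- by move=> v; rewrite leqNgt hD.
- by move=> v; apply: ltnW.
- move=> v t; rewrite inE => /eqP[-> ->]; rewrite subnn leqnn addn0.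
  by split=> //; constructor.
- by rewrite inE eqxx ?orbT.
- by rewrite leqnn leq_addr.
Qed.

(** All pending events are strictly later than a clock whose bucket is empty. One of them exists and
    obeys the bound on event times, which keeps the clock below that bound and so limits the number
    of ticks. *)
Lemma search_inv_tick D now S Q :
  search_inv D now S Q -> 0 < size Q -> (forall v, (v, now) \notin Q) ->
  search_inv D now.+1 S Q /\ now < tau + size S * W.
Proof.
move=> [h1 h2 h3 h4 h5 h6 h7 h8] Q0 no.
have lt v t : (v, t) \in Q -> now < t.
  move=> vt; have [_ lt _ _] := h5 _ _ vt; rewrite ltn_neqAle lt andbT.
  by apply: contraTneq vt => <-.
have up : now < tau + size S * W.
  case: Q Q0 h5 lt {no h6 h7} => // -[v t] Q _ h5 lt.
  have [_ _ le _] := h5 v t (mem_head _ _).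
  by apply: leq_trans le; apply: (lt v); apply: mem_head.
split=> //; split=> //.
- by move=> v; apply: leqW.
- by move=> v t vt; have [? _ ? ?] := h5 _ _ vt; split=> //; apply: lt vt.
- by rewrite up andbT; case/andP: h8 => ? _; apply: leqW.
Qed.

(** The node was settled no later than [now], so any obligation met by the event is already met by
    its settling time. *)
Lemma search_inv_drop D now S Q v Q' :
  search_inv D now S Q -> v \in S -> Q =i (v, now) :: Q' ->
  search_inv D now S Q'.
Proof.
move=> [h1 h2 h3 h4 h5 h6 h7 h8] vS QE.
have keep x t : (x \in S) && (D x <= t) || ((x, t) \in Q) ->
    (x \in S) && (D x <= t) || ((x, t) \in Q').
  rewrite QE inE xpair_eqE => /orP[->//|/orP[/andP[/eqP-> /eqP->]|->]].
    by rewrite vS h3.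
  by rewrite orbT.
split=> //.
- by move=> x t xt; apply: h5; rewrite QE inE xt orbT.
- by move=> u x c uS ux; apply: keep; apply: h6.
- exact: keep.
Qed.

(** The event certifies a walk of weight [now - tau] to [v]. The new events come at most [W] after
    [now], which the growth of [S] by one node absorbs. Minimality of the settling time is left to
    [search_inv_done]. *)
Lemma search_inv_settle D now S Q v Q' D' Q'' :
  (forall e, e \in es -> e.2 <= W) ->
  search_inv D now S Q -> v \notin S -> Q =i (v, now) :: Q' ->
  (forall x, D' x = if x == v then now else D x) ->
  (forall e, (e \in Q'') =
     (e \in [seq (x.1, now + x.2) | x <- adjacency es v]) || (e \in Q')) ->
  search_inv D' now (v :: S) Q''.
Proof.
move=> hW [h1 h2 h3 h4 h5 h6 h7 h8] vS QE DE QE''.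
have [vtau _ vle wv] : [/\ tau <= now, now <= now, now <= tau + size S * W &
    walk es s v (now - tau)] by apply: h5; rewrite QE mem_head.
have keep x t : (x \in S) && (D x <= t) || ((x, t) \in Q) ->
    (x \in v :: S) && (D' x <= t) || ((x, t) \in Q'').
  rewrite QE DE !inE xpair_eqE QE''; case: eqP => [->|_] /=.
    rewrite (negPf vS) /=; case: eqP => [->|_] /= h; first by rewrite leqnn.
    by rewrite h !orbT.
  by case/orP => -> //; rewrite !orbT.
have mono : tau + size S * W <= tau + size (v :: S) * W by rewrite /= mulSn; lia.
split.
- by move=> x; rewrite inE DE h1; case: eqP => [->|].
- by rewrite /= vS.
- by move=> x; rewrite DE; case: eqP.
- move=> x; rewrite inE DE; case: eqP => [->|_] //=; exact: h4.
- move=> x t; rewrite QE'' => /orP[/mapP[[y c]]|xt]; last first.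
    have [a b cc d] : [/\ tau <= t, now <= t, t <= tau + size S * W &
      walk es s x (t - tau)] by apply: h5; rewrite QE inE xt orbT.
    by split=> //; apply: leq_trans mono.
  rewrite mem_adjacency => hy [-> ->] /=; rewrite leq_addr.
  split=> //; first by apply: leq_trans (leq_addr _ _).
    by have /= := hW _ hy; rewrite mulSn; lia.
  by rewrite -addnBAC //; apply: walk_rcons hy.
- move=> u x c; rewrite inE (DE u); case: eqP => [-> _ hx|_ /= uS hx].
    rewrite QE'' (map_f (fun x : nat * nat => (x.1, now + x.2)) (x := (x, c))) ?orbT //.
    by rewrite mem_adjacency.
  by apply: keep; apply: h6.
- exact: keep.
- by case/andP: h8 => -> h8 /=; apply: leq_trans mono.
Qed.

(** For a reachable [v], [D v - tau] is its distance from [s]; the entries below [tau] are stale and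
    belong to the unreachable nodes. *)
Definition shortest (D : nat -> nat) : Prop :=
  (forall v, tau <= D v -> walk es s v (D v - tau)) /\
  (forall v n, walk es s v n -> tau <= D v <= tau + n).

(** With an empty queue, closure says [D v <= D u + c] for every edge leaving a settled node.
    Induction along a walk turns this into the lower bound on its weight. *)
Lemma search_inv_done D now S : search_inv D now S [::] -> shortest D.
Proof.
move=> [h1 h2 h3 h4 h5 h6 h7 h8]; split=> [v|v n]; first by rewrite -h1; apply: h4.
elim=> [|x y c p _ IH hy].
  by move: h7; rewrite orbF h1 addn0.
case/andP: IH => tx lex; have := h6 x y c; rewrite h1 => /(_ tx hy).
by rewrite orbF h1 => /andP[-> ?] /=; lia.
Qed.

(** A settled node is the source or the target of some edge, and [S] has no duplicates. Hence one
    search moves the clock within its invariant by at most [size N * W]. *)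
Lemma search_inv_size D now S Q N :
  search_inv D now S Q ->
  (forall v, (v == s) || (v \in [seq e.1.2 | e <- es]) -> v \in N) ->
  size S <= size N.
Proof.
move=> [_ h2 _ h4 _ _ _ _] hN; apply: uniq_leq_size => // v /h4/walk_target h.
by apply: hN; case: h => [->|->]; rewrite ?eqxx ?orbT.
Qed.

End SearchInvariant.

(* The clock is never reset: a later search starts at a time [ST] beyond all
   settling times, so a node is settled in the current search iff its entry in
   [DI] is at least [ST], and no array has to be cleared between searches.  An
   event whose node is already settled is dropped when it comes up. *)
Definition search (src : expr) : cmd :=
  (set_var ST (var NOW) ;;
   push src (var NOW) ;;
   While (var PD)
     (If (Get BH (var NOW))
        (set_var U (Get EV (Get BH (var NOW))) ;;
         Put BH (var NOW) (Get EN (Get BH (var NOW))) ;;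
         set_var PD (Defs.Sub (var PD) (Lit 1)) ;;
         If (Defs.Sub (var ST) (Get DI (var U)))
           (Put DI (var U) (var NOW) ;;
            set_var PT (Get HD (var U)) ;;
            While (var PT)
              (push (Get TG (var PT)) (Add (var NOW) (Get WT (var PT))) ;;
               set_var PT (Get NX (var PT))))
           Skip)
        (set_var NOW (Add (var NOW) (Lit 1)))) ;;
   set_var NOW (Add (var NOW) (Lit 1)))%cmd.

Definition search_frame := [:: ST; NOW; U; PT; DI] ++ push_frame.

(** Locates the first event of a bucket inside the list of all pending events, so that it can be
    removed there. *)
Lemma filter_split (X : Type) (a : pred X) s x l :
  filter a s = x :: l ->
  exists s1 s2, [/\ s = s1 ++ x :: s2, ~~ has a s1, a x & filter a s2 = l].
Proof.
elim: s => //= y s IH; case: ifPn => [ay [<- <-]|ay].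
  by exists [::], s.
move=> /IH[s1 [s2 [-> h1 h2 h3]]]; exists (y :: s1), s2; split=> //=.
by rewrite negb_or ay.
Qed.

Lemma stores_edges_frame m m' es Z :
  frame Z m m' -> ~~ has (mem [:: HD; NX; TG; WT; NE]) Z ->
  stores_edges m es -> stores_edges m' es.
Proof.
move=> fr /hasPn disj h u.
have fr' b j : b \in [:: HD; NX; TG; WT; NE] -> m' b j = m b j.
  by move=> hb; apply: fr; apply: contraL hb => /disj.
rewrite !fr' //; apply: chain_ext (h u) => // q _; by rewrite !fr'.
Qed.

(** * Correctness and cost of the search program *)

Section Search.
Variables (world : Type) (post : world -> memory -> world -> memory -> Prop).
Variable w : world.
Local Notation wp := (wp post w).

Lemma wp_search src m o (es : seq triple) W (N : seq nat) :
  stores_edges m es -> stores_events m [::] ->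
  (forall v, m DI v < m NOW 0) ->
  (forall n, eval (update m ST 0 n) src = eval m src) ->
  (forall e, e \in es -> e.2 <= W) ->
  (forall v, (v == eval m src) || (v \in [seq e.1.2 | e <- es]) -> v \in N) ->
  wp (search src) (cost src + 300 + 200 * size es + 50 * (size N * W))
    (fun=> fun m' o' => [/\ o' = o,
       stores_events m' [::], frame search_frame m m',
       shortest es (eval m src) (m' ST 0) (m' DI) &
       forall v, m' DI v < m' NOW 0 /\ m' DI v <= m' ST 0 + size N * W]) m o.
Proof.
move=> hes hev hD hsrc hW hN; rewrite /search.
move: {2 3}(size N * W) (erefl (size N * W)) => NW eNW.
seq_assign; set s := eval m src in hN *; set tau := m NOW 0.
have hev0 : stores_events (update m ST 0 tau) [::] by exact: hev.
apply: wp_seq; apply: wp_call; [apply: wp_push; [exact: hev0 | by []] | simpl; lia | ].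
move=> B m1 _ hB [-> hev1 fr1]; rewrite hsrc in hev1.
have {hB} : 200 + 200 * size es + 50 * NW <= B.
  by move: hB => /=; lia.
move=> hB.
(* The last clause is a potential: 70 credits for each pending event, 200 for each edge whose source
   is unsettled, and 50 for each tick that the clock may still make. *)
pose I := fun (B : nat) (m' : memory) (o' : seq nat) => o' = o /\
  exists S P, [/\ stores_events m' P,
    search_inv es s tau W (m' DI) (m' NOW 0) S P,
    frame search_frame m m', m' ST 0 = tau &
    70 * size P + 200 * count (fun e : triple => e.1.1 \notin S) es
      + 50 * (tau + NW - m' NOW 0) + 60 <= B].
apply: wp_seq; apply: (wp_while (Inv := I)); last first.
  split=> //; exists [::], [:: (s, tau)]; split=> //.
  - have -> : m1 NOW 0 = tau by rewrite (fr1 NOW isT).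
    apply: search_inv_init => v; rewrite (fr1 DI isT); exact: hD.
  - apply: (@frame_trans _ _ (update m ST 0 tau)).
      by apply: frame_update.
    by apply: frame_sub fr1.
  - by rewrite (fr1 ST isT).
  - by rewrite (fr1 NOW isT) updateE /= -/tau count_predT addKn; lia.
move=> {hev0 fr1 hev1 m1 hB B} B m1 _ [-> [S [P [hev1 inv fr1 hst hB]]]].
have [hpd hbk] := hev1; rewrite /= hpd.
have szS := search_inv_size inv hN.
split; first by lia.
case: ifPn => [P0|]; last first.
  rewrite negbK => /eqP/size0nil P0; subst P.
  assign; split=> //.
  - by repeat (apply: frame_update => //).
  - by rewrite ?updateE /= hst; apply: search_inv_done inv.
  (* The final increment of the clock puts all settling times strictly in the past, as the next
     search requires. *)
  - move=> v; rewrite ?updateE /=; case: inv => _ _ h3 _ _ _ _ h8.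
    rewrite hst addn1 ltnS h3; split=> //; case/andP: h8 => _ h8.
    by apply: leq_trans (h3 v) (leq_trans h8 _); rewrite leq_add2l leq_mul2r szS orbT.
have hSW : size S * W <= NW by rewrite -eNW leq_mul2r szS orbT.
apply: wp_if; first by rewrite /=; lia.
rewrite /=; case: ifPn => [bh|]; last first.
  rewrite negbK => /eqP bh0.
  have no v : (v, m1 NOW 0) \notin P.
    have := hbk (m1 NOW 0); rewrite bh0.
    case E: [seq x.1 | x <- P & x.2 == m1 NOW 0] => [|a l] /= => [_|[]//].
    apply/negP => h; suff : v \in [::] by [].
    rewrite -E; apply/mapP; exists (v, m1 NOW 0) => //; by rewrite mem_filter /= eqxx.
  have [inv' lt] : search_inv es s tau W (m1 DI) (m1 NOW 0).+1 S P /\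
     m1 NOW 0 < tau + size S * W by apply: search_inv_tick => //; lia.
  have {}lt : m1 NOW 0 < tau + NW by apply: leq_trans lt _; rewrite leq_add2l.
  assign; split=> //; exists S, P; split=> //.
  - by rewrite updateE /= addn1.
  - by repeat (apply: frame_update => //).
  - by rewrite updateE; move: hB => /=; lia.
set now := m1 NOW 0 in inv hB bh *.
have hch := hbk now.
case E: [seq x <- P | x.2 == now] hch => [|[v t] l] /=; first by move/eqP: bh.
case=> _ bhn hv hch.
have [P1 [P2 [PE hP1 /= /eqP tn lE]]] := filter_split E.
subst t.
do 3 seq_assign; rewrite -/now hv.
apply: wp_if; first by rewrite /=; lia.
rewrite /= !updateE /= hst.
set m2 := update _ PD 0 _.
pose P' := P1 ++ P2.
have QE : P =i (v, now) :: P'.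
  by move=> x; rewrite PE !(inE, mem_cat); do ?case: (_ \in _); rewrite ?orbT ?orbF.
have szP : size P = (size P').+1 by rewrite PE !size_cat /= addnS.
have hev2 : stores_events m2 P'.
  split; first by rewrite /m2 !updateE /= hpd szP subn1.
  move=> r; rewrite /m2 !updateE /=.
  have := hbk r; rewrite PE /P' !filter_cat /= (eq_sym now r).
  case: eqP => [->|_] h.
    have -> : [seq x <- P1 | x.2 == now] = [::].
      by apply/eqP; move: hP1; rewrite has_filter negbK.
    by rewrite lE.
  exact: h.
have fr2 : frame search_frame m m2 by repeat (apply: frame_update => //).
have hvS := inv_settled inv v.
case: ifPn => [unset|]; last first.
  rewrite negbK subn_eq0 -hvS => vS.
  apply: wp_skip; first by lia.
  split=> //; exists S, P'; split=> //.
  - by rewrite /m2 !updateE /= ; apply: search_inv_drop inv vS QE.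
  - by move: hB; rewrite szP /m2 !updateE /= -/now; move: (size P') => n; lia.
have vS : v \notin S by rewrite hvS -subn_eq0.
do 2 seq_assign.
set m3 := update _ PT 0 _.
have fr3 : frame search_frame m m3 by repeat (apply: frame_update => //).
(* Settling [v] releases the credits of exactly the edges that leave [v]. *)
have cnt : count (fun e : triple => e.1.1 \notin S) es =
    count (fun e : triple => e.1.1 \notin v :: S) es + size (adjacency es v).
  rewrite size_map size_filter addnC -count_predUI.
  rewrite [X in _ = _ + X](_ : _ = 0); last first.
    by rewrite -(count_pred0 es); apply: eq_count => e /=; rewrite inE negb_or; case: eqP.
  rewrite addn0; apply: eq_count => e /=; rewrite inE negb_or.
  by case: eqP => [->|].
have now3 : m3 NOW 0 = now by [].
have di3 x : m3 DI x = if x == v then now else m1 DI x.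
  by rewrite /m3 /m2 !updateE /=.
have hev3 : stores_events m3 P' by exact: hev2.
have ch3 : chain (m NX) (fun p => (m TG p, m WT p)) (m NE 0) (m3 PT 0) (adjacency es v).
  by have := hes v; rewrite /m3 /m2 !updateE /= (fr1 HD isT).
(* The events of the unscanned edges [l] together with [P''] always form the queue expected after
   the scan. The 170 credits of an unscanned edge pay for its push and for the 70 credits of the new
   event. *)
pose I' := fun (B : nat) (m' : memory) (o' : seq nat) => o' = o /\
  exists l P'', [/\ stores_events m' P'',
    chain (m NX) (fun p => (m TG p, m WT p)) (m NE 0) (m' PT 0) l,
    (forall e, (e \in [seq (x.1, now + x.2) | x <- adjacency es v]) || (e \in P') =
               (e \in [seq (x.1, now + x.2) | x <- l]) || (e \in P'')),
    frame search_frame m3 m' /\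
      [/\ m' NOW 0 = now, m' ST 0 = tau & forall x, m' DI x = m3 DI x] &
    170 * size l + 70 * size P'' + 200 * count (fun e : triple => e.1.1 \notin v :: S) es
      + 50 * (tau + NW - now) + 70 <= B].
apply: (wp_while (Inv := I')); last first.
  split=> //; exists (adjacency es v), P'; split=> //.
  move: hB; rewrite cnt szP /=.
  by move: (size P') (size (adjacency es v)) (count _ _) => a b c; lia.
move=> {hB B} B m4 _ [-> [l' [P'' [hev4 ch4 QE4 [fr4 [now4 st4 di4]] hB]]]].
split; first by rewrite /=; lia.
have frm := frame_trans fr3 fr4.
rewrite /=; case: l' ch4 QE4 hB => [|[x c] l'] /= ch4 QE4 hB.
  rewrite ch4 /=; split=> //; exists (v :: S), P''; split=> //; last first.
    by move: hB; rewrite now4 /=; lia.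
  rewrite now4; apply: search_inv_settle inv vS QE _ _ => // y; rewrite QE4.
case: ch4 => pt0 ptn [xE cE] ch4; rewrite -lt0n pt0.
apply: wp_seq; apply: wp_call; [apply: wp_push; [exact: hev4|] | simpl; lia | ].
  by rewrite /= !updateE.
move=> B' m5 _ hB' [-> /=]; rewrite now4 (frm TG isT) (frm WT isT) xE cE => hev5 fr5.
have [now5 pt5] : m5 NOW 0 = now /\ m5 PT 0 = m4 PT 0 by rewrite !fr5.
have {}hB : 170 * size l' + 70 * (size P'').+1 +
    200 * count (fun e : triple => e.1.1 \notin v :: S) es
      + 50 * (tau + NW - now) + 90 <= B'.
  by move: hB hB' => /=; lia.
assign.
have fr35 : frame search_frame m3 m5.
  by apply: frame_trans fr4 _; apply: frame_sub fr5.
split=> //; exists l', ((x, now + c) :: P''); split=> //.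
- by rewrite updateE /= (frame_trans fr3 fr35) // pt5.
- by move=> e; rewrite QE4 /= !inE orbCA -!orbA.
- split; first by apply: frame_update.
  by split=> [||y]; rewrite !updateE /= ?now5 ?fr5.
- by move: hB => /=; lia.
Qed.

End Search.

(** * The programs of the sites and of the coordinator *)

(** Sites read one edge per index (stride 1); the coordinator receives each edge as three
    consecutive numbers (stride 3). Accordingly [n] is the number of entries to cover, in units of
    the index [J]. *)
Definition build (n a b c : expr) (stride : nat) : cmd :=
  (set_var J (Lit 0) ;;
   While (Defs.Sub n (var J))
     (add_edge a b c ;; set_var J (Add (var J) (Lit stride))))%cmd.

Definition build_frame := J :: add_edge_frame.

Definition flat (tr : seq triple) : seq nat :=
  flatten [seq [:: e.1.1; e.1.2; e.2] | e <- tr].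

Lemma flat_cat tr1 tr2 : flat (tr1 ++ tr2) = flat tr1 ++ flat tr2.
Proof. by rewrite /flat map_cat flatten_cat. Qed.

Lemma size_flat tr : size (flat tr) = 3 * size tr.
Proof. by elim: tr => //= e tr; rewrite /flat /= => ->; lia. Qed.

Lemma nth_flat tr j : j < size tr ->
  nth (0, 0, 0) tr j = (nth 0 (flat tr) (3 * j), nth 0 (flat tr) (3 * j).+1,
                        nth 0 (flat tr) (3 * j).+2).
Proof.
elim: tr j => // -[[u v] d] tr IH [|j] //; rewrite mulnS ltnS => /IH.
by rewrite /flat /=.
Qed.

(** The contract of a report [tr] on the distances from [us] to [vs]. Its size counts only sources
    with an outgoing edge: [s] is a source at every site, but must be paid for only where it has
    edges. *)
Record summarizes (es : seq triple) (N : nat) (us vs : seq nat)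
    (tr : seq triple) : Prop := Summarizes {
  summary_sound : forall u v d, (u, v, d) \in tr ->
    [/\ u \in us, v \in vs, 0 < d <= N & walk es u v d];
  summary_complete : forall u v n, u \in us -> v \in vs -> walk es u v n ->
    u = v \/ exists2 d, d <= n & (u, v, d) \in tr;
  summary_size :
    size tr <= count (fun u => has (fun e : triple => e.1.1 == u) es) us * size vs
}.

Lemma walk_eq0 es u v :
  (forall e, e \in es -> 0 < e.2) -> walk es u v 0 -> u = v.
Proof.
move=> pos w; case: {-2}_ / w (erefl 0) => // x y c n _ /pos /=; lia.
Qed.

Lemma summarizes_rcons_target es N u vs tr v tau D :
  (forall e, e \in es -> 0 < e.2) ->
  shortest es u tau D -> D v <= tau + N ->
  summarizes es N [:: u] vs tr ->
  summarizes es N [:: u] (rcons vs v)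
    (tr ++ if tau < D v then [:: (u, v, D v - tau)] else [::]).
Proof.
move=> pos [sh1 sh2] hN [h1 h2 h3]; split.
- move=> x y d; rewrite mem_cat mem_rcons inE => /orP[/h1[? hy ? ?]|].
    by rewrite hy orbT.
  case: ifP => // lt; rewrite inE => /eqP[-> -> ->].
  rewrite inE !eqxx; split=> //; first by lia.
  by apply: sh1; apply: ltnW.
- move=> x y n; rewrite inE mem_rcons inE => /eqP-> /orP[/eqP->|hy] w; last first.
    case: (h2 u y n) => // [||[d dn hd]]; rewrite ?mem_head //; first by left.
    by right; exists d => //; rewrite mem_cat hd.
  have /andP[] := sh2 _ _ w; rewrite leq_eqVlt => /orP[/eqP e _|lt le].
    left; apply: (walk_eq0 (es := es)) => //.
    by have := sh1 v; rewrite -e leqnn subnn; apply.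
  by right; exists (D v - tau); [lia | rewrite lt mem_cat inE eqxx orbT].
- rewrite size_cat size_rcons mulnS addnC leq_add //; case: ifP => // lt.
  (* A source without outgoing edges reaches only itself, at distance 0, so it reports nothing. *)
  rewrite /= addn0 lt0b; apply: contraLR lt => no; rewrite -leqNgt.
  have [lt|//] := ltnP tau (D v).
  have e := walk_no_source no (sh1 v (ltnW lt)).
  by have := sh2 u 0 (walk_nil _ _); rewrite addn0 => /andP[_]; rewrite leqNgt -e lt.
Qed.

Lemma summarizes_nil_target es N us : summarizes es N us [::] [::].
Proof. by split. Qed.

Lemma summarizes_nil_source es N vs : summarizes es N [::] vs [::].
Proof. by split. Qed.

Lemma summarizes_rcons_source es N us u vs tr tr' :
  summarizes es N us vs tr -> summarizes es N [:: u] vs tr' ->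
  summarizes es N (rcons us u) vs (tr ++ tr').
Proof.
move=> [a1 a2 a3] [b1 b2 b3]; split.
- move=> x y d; rewrite mem_cat mem_rcons inE => /orP[/a1[-> ? ? ?]|/b1[]].
    by rewrite orbT.
  by rewrite inE => ->.
- move=> x y n; rewrite mem_rcons inE => /orP[xu|xus] hy w.
    case: (b2 x y n) => // [||[d dn hd]]; [by rewrite inE|by left|].
    by right; exists d => //; rewrite mem_cat hd orbT.
  case: (a2 x y n) => // [|[d dn hd]]; first by left.
  by right; exists d => //; rewrite mem_cat hd.
- rewrite size_cat -cats1 count_cat mulnDl; exact: leq_add.
Qed.

(* Pairs at distance 0 are not reported.  Hence a source without outgoing edges
   causes no traffic. *)
Definition report : cmd :=
  (set_var L (Lit 0) ;;
   While (Defs.Sub (Get 1 (Lit 1)) (var L))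
     (If (Defs.Sub (Get DI (Get 3 (var L))) (var ST))
        (Send (Get 4 (var J)) ;; Send (Get 3 (var L)) ;;
         Send (Defs.Sub (Get DI (Get 3 (var L))) (var ST)))
        Skip ;;
      set_var L (Add (var L) (Lit 1))))%cmd.

(** The clock starts at 1, so that the initial zeros in [DI] count as unsettled. *)
Definition site_program : cmd :=
  (build (Get 1 (Lit 3)) (Get 5 (var J)) (Get 6 (var J)) (Lit 1) 1 ;;
   set_var NOW (Lit 1) ;;
   Put 4 (Get 1 (Lit 2)) (Get 0 (Lit 0)) ;;
   Put 1 (Lit 2) (Add (Get 1 (Lit 2)) (Lit 1)) ;;
   Put 3 (Get 1 (Lit 1)) (Get 0 (Lit 1)) ;;
   Put 1 (Lit 1) (Add (Get 1 (Lit 1)) (Lit 1)) ;;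
   set_var J (Lit 0) ;;
   While (Defs.Sub (Get 1 (Lit 2)) (var J))
     (search (Get 4 (var J)) ;; report ;; set_var J (Add (var J) (Lit 1))))%cmd.

Section Site.
Variables (world : Type) (post : world -> memory -> world -> memory -> Prop).
Variable w : world.
Local Notation wp := (wp post w).

Lemma wp_build n a b c stride (el : seq triple) m o :
  0 < stride ->
  stores_edges m [::] ->
  (forall m', frame build_frame m m' -> eval m' n = stride * size el) ->
  (forall m' j, frame build_frame m m' -> j < size el -> m' J 0 = stride * j ->
     (eval m' a, eval m' b, eval m' c) = nth (0, 0, 0) el j) ->
  wp (build n a b c stride)
    (20 + cost n + (100 + cost n + cost a + cost b + cost c) * size el)
    (fun=> fun m' o' => [/\ o' = o, stores_edges m' (rev el) &
       frame build_frame m m']) m o.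
Proof.
move=> st0 hes hn habc; rewrite /build; seq_assign.
set C := 100 + _ + _ + _ + _.
pose I := fun (B : nat) (m' : memory) (o' : seq nat) => o' = o /\
  exists j, [/\ j <= size el, m' J 0 = stride * j,
    stores_edges m' (rev (take j el)), frame build_frame m m' &
    C * (size el - j) + 10 + cost n <= B].
apply: (wp_while (Inv := I)); last first.
  split=> //; exists 0; split=> //; first by rewrite updateE /= muln0.
  - by rewrite take0.
  - by apply: frame_update.
  - by rewrite subn0 /=; move: (C * size el) => k; lia.
move=> B m1 _ [-> [j [jle j1 hes1 fr1 hB]]].
split; first by move: hB => /=; move: (C * _) => k; lia.
rewrite /= hn // j1 -mulnBr muln_eq0 negb_or -!lt0n st0 subn_gt0 /=.
case: ltnP => [jlt|jge]; last first.
  have ej : j = size el by apply/eqP; rewrite eqn_leq jle.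
  by split=> //; rewrite -[el]take_size -ej.
have {hB} hB : C * (size el - j.+1) + C + 10 + cost n <= B.
  by apply: leq_trans hB; rewrite -mulnSr -subSn // subSS.
rewrite /C in hB.
have ev m' : frame build_frame m1 m' -> m' J 0 = stride * j ->
   (eval m' a, eval m' b, eval m' c) = nth (0, 0, 0) el j.
  by move=> fr; apply: habc => //; apply: frame_trans fr1 fr.
case E: (nth (0, 0, 0) el j) ev => [[x y] z] ev.
apply: wp_seq; apply: wp_call.
- apply: (@wp_add_edge _ _ _ _ _ _ _ _ _ x y z); [exact: hes1| | |].
  + by case: (ev m1 (@frame_refl _ _) j1).
  + move=> k; have /ev/(_ j1)[] // : frame build_frame m1 (update m1 X1 0 k).
    exact: frame_update.
  + move=> k k'.
    have /ev/(_ j1)[] // : frame build_frame m1 (update (update m1 X1 0 k) X2 0 k').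
    by do 2 apply: frame_update => //.
- by move: hB => /=; move: (_ * (size el - j.+1)) => k; lia.
move=> B' m2 _ hB' [-> hes2 fr2].
have {hB' hB}hB : C * (size el - j.+1) + 10 + cost n + 10 <= B'.
  by move: hB hB'; rewrite /C /=; move: (_ * (size el - j.+1)) => k; lia.
apply: wp_put; [by move: hB => /=; move: (C * _) => k; lia | rewrite /=].
split=> //; exists j.+1; split=> //.
- by rewrite updateE /= fr2 // j1 mulnS addnC.
- by rewrite (take_nth (0, 0, 0)) // E rev_rcons.
- apply: frame_update => //; apply: frame_trans fr1 _; exact: frame_sub fr2.
- by move: hB => /=; move: (C * _) => k; lia.
Qed.

Lemma wp_report es u vs N m o :
  (forall e, e \in es -> 0 < e.2) ->
  shortest es u (m ST 0) (m DI) ->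
  (forall v, m DI v <= m ST 0 + N) ->
  m 1 1 = size vs -> (forall j, j < size vs -> m 3 j = nth 0 vs j) ->
  m 4 (m J 0) = u ->
  wp report (20 + 80 * size vs)
    (fun=> fun m' o' => frame [:: L] m m' /\
       exists2 tr, o' = o ++ flat tr & summarizes es N [:: u] vs tr) m o.
Proof.
move=> pos sh hN hsz hvs hu; rewrite /report; seq_assign.
pose I := fun (B : nat) (m' : memory) (o' : seq nat) => 
  exists j tr, [/\ j <= size vs, m' L 0 = j, frame [:: L] m m',
    o' = o ++ flat tr /\ summarizes es N [:: u] (take j vs) tr &
    80 * (size vs - j) + 10 <= B].
apply: (wp_while (Inv := I)); last first.
  exists 0, [::]; split=> //; first by apply: frame_update.
  - by rewrite cats0 take0; split=> //; apply: summarizes_nil_target.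
  - by rewrite subn0; lia.
move=> B m1 _ [j [tr [jle j1 fr1 [-> hsum] hB]]].
split; first by rewrite /=; lia.
rewrite /= (fr1 1 isT) hsz j1 subn_eq0 -ltnNge.
case: ltnP => jlt; last first.
  have ej : j = size vs by apply/eqP; rewrite eqn_leq jle.
  by split=> //; exists tr; rewrite // -(take_size vs) -ej.
apply: wp_seq; apply: wp_if; first by rewrite /=; lia.
(* The truncated difference of [DI] and [ST] is nonzero exactly for nodes reached at positive
   distance in the current search. *)
rewrite /= j1 (fr1 3 isT) (fr1 DI isT) (fr1 ST isT) hvs // subn_eq0 -ltnNge.
have := summarizes_rcons_target pos sh (hN (nth 0 vs j)) hsum.
rewrite -take_nth //; set v := nth 0 vs j.
case: ltnP => hv hsum'.
- apply: wp_seq; apply: wp_send; first by rewrite /=; lia.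
  apply: wp_seq; apply: wp_send; first by rewrite /=; lia.
  apply: wp_send; first by rewrite /=; lia.
  assign; exists j.+1, (tr ++ [:: (u, v, m DI v - m ST 0)]); split=> //.
  + by rewrite updateE /= j1 addn1.
  + by apply: frame_update.
  + split=> //; rewrite flat_cat catA -!cats1 -!catA /= j1.
    by rewrite !(fr1 3 isT, fr1 4 isT, fr1 J isT, fr1 DI isT, fr1 ST isT) hu hvs //.
  + by lia.
- apply: wp_skip; first by lia.
  assign; exists j.+1, tr; split=> //.
  + by rewrite updateE /= j1 addn1.
  + by apply: frame_update.
  + by rewrite cats0 in hsum'.
  + by lia.
Qed.

(* The query is appended to the stored lists of in-nodes and virtual nodes: [s]
   becomes a source and [t] a target of the local searches.  No membership test
   is needed, since a node outside the fragment has no edge there. *)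
Lemma wp_site us vs (el : seq (nat * nat)) s t m (N : seq nat) :
  (forall b j, 10 <= b -> m b j = 0) ->
  m 0 0 = s -> m 0 1 = t ->
  m 1 1 = size vs -> m 1 2 = size us -> m 1 3 = size el ->
  (forall j, m 3 j = nth 0 vs j) -> (forall j, m 4 j = nth 0 us j) ->
  (forall j, m 5 j = nth 0 (unzip1 el) j) ->
  (forall j, m 6 j = nth 0 (unzip2 el) j) ->
  (forall v, v \in rcons us s ++ unzip2 el -> v \in N) ->
  let es := rev [seq (e.1, e.2, 1) | e <- el] in
  wp site_program
    (200 + 150 * size el +
     (size us).+1 * (500 + 200 * size el + 50 * size N + 80 * size vs))
    (fun=> fun m' o' => exists2 tr, o' = flat tr &
       summarizes es (size N) (rcons us s) (rcons vs t) tr) m [::].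
Proof.
move=> zero h00 h01 h11 h12 h13 h3 h4 h5 h6 hN es; rewrite /site_program.
set C := 500 + _ + _ + _.
apply: wp_seq; apply: wp_call.
- apply: (@wp_build _ _ _ _ _ [seq (e.1, e.2, 1) | e <- el]) => //.
  + by move=> u; rewrite /= zero.
  + by move=> m' fr; rewrite /= fr // size_map mul1n.
  + move=> m' j fr; rewrite size_map mul1n => jlt jE.
    rewrite /= (fr 5 isT) (fr 6 isT) jE h5 h6 (nth_map (0, 0)) //.
    by rewrite !(nth_map (0, 0)).
- by rewrite size_map /=; move: (_.+1 * C) => k; lia.
move=> B m1 _ hB [-> hes fr1]; rewrite -/es in hes.
have {}hB : 60 + (size us).+1 * C <= B.
  by move: hB; rewrite size_map /=; move: (_.+1 * C) => k; lia.
have B60 : 60 <= B by move: hB; move: (_.+1 * C) => k; lia.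
do 6 seq_assign.
rewrite !fr1 //= h12 h11 h00 h01.
set m2 := update _ J 0 _; set B2 := B - _ - _ - _ - _ - _ - _.
have hB2 : 20 + (size us).+1 * C <= B2.
  by move: hB; rewrite /B2; move: (_.+1 * C) => k; lia.
have us2 j : j <= size us -> m2 4 j = nth 0 (rcons us s) j.
  move=> jle; rewrite /m2 !updateE /= fr1 // h4 nth_rcons.
  by rewrite ltn_neqAle jle andbT; case: eqP.
have vs2 j : j <= size vs -> m2 3 j = nth 0 (rcons vs t) j.
  move=> jle; rewrite /m2 !updateE /= fr1 // h3 nth_rcons.
  by rewrite ltn_neqAle jle andbT; case: eqP.
have pos e : e \in es -> 0 < e.2 by rewrite mem_rev => /mapP[x _ ->].
have one e : e \in es -> e.2 <= 1 by rewrite mem_rev => /mapP[x _ ->].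
have tgt v : v \in [seq e.1.2 | e <- es] -> v \in N.
  rewrite map_rev mem_rev -map_comp => h; apply: hN.
  by rewrite mem_cat (_ : v \in unzip2 el) ?orbT.
have srcN j : j <= size us -> nth 0 (rcons us s) j \in N.
  by move=> jle; apply: hN; rewrite mem_cat mem_nth // size_rcons.
have szes : size es = size el by rewrite size_rev size_map.
pose W2 := J :: L :: search_frame.
(* Between two searches the queue is empty and all settling times precede the clock, which is what
   [wp_search] needs in place of cleared arrays. *)
pose I := fun (B : nat) (m' : memory) (o' : seq nat) => 
  exists j tr, [/\ j <= (size us).+1, m' J 0 = j /\ frame W2 m2 m',
    stores_events m' [::] /\ (forall v, m' DI v < m' NOW 0),
    o' = flat tr /\ summarizes es (size N) (take j (rcons us s)) (rcons vs t) tr &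
    C * ((size us).+1 - j) + 20 <= B].
apply: (wp_while (Inv := I)); last first.
  exists 0, [::]; split=> //.
  - split=> [|v]; last by rewrite /m2 !updateE /= fr1 // zero.
    by split=> [|u]; rewrite /m2 !updateE /= fr1 // zero.
  - by rewrite take0; split=> //; apply: summarizes_nil_source.
  - by rewrite subn0 mulnC addnC.
move=> {hB B60 hB2 B2 B} B m3 _ [j [tr [jle [j3 fr3] [hev hD] [-> hsum] hB]]].
have B20 : 20 <= B by move: hB; move: (C * _) => k; lia.
split; first by rewrite /=; lia.
rewrite /= j3 (fr3 1 isT) /= {1}/m2 !updateE /= subn_eq0 -ltnNge addn1 ltnS.
case: leqP => [{}jle|jgt]; last first.
  have ej : j = (size us).+1 by apply/eqP; rewrite eqn_leq jle.
  exists tr => //; rewrite -(take_size (rcons us s)) size_rcons -ej //.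
have {}hB : C * (size us - j) + C + 20 <= B.
  by apply: leq_trans hB; rewrite -mulnSr subSn.
have src : eval m3 (Get 4 (var J)) = nth 0 (rcons us s) j.
  by rewrite /= j3 (fr3 4 isT) us2.
set u := nth 0 (rcons us s) j in src.
have hes3 : stores_edges m3 es.
  by apply: (stores_edges_frame fr3) => //; exact: hes.
apply: wp_seq; apply: wp_call.
- apply: (wp_search post w _ (W := 1) (N := N) hes3 hev hD) => //.
  move=> v; rewrite src => /orP[/eqP->|]; [exact: srcN | exact: tgt].
- by move: hB; rewrite /C szes muln1 /=; move: (_ * (size us - j)) => k; lia.
move=> B' m4 _ hB' [-> hev4 fr4 sh4 hD4]; rewrite src in sh4.
have {hB'}hB : C * (size us - j) + 20 + 80 * (size vs).+1 + 50 <= B'.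
  by move: hB hB'; rewrite /C szes muln1 /=; move: (_ * (size us - j)) => k; lia.
apply: wp_seq; apply: wp_call.
- apply: (wp_report _ (vs := rcons vs t) (N := size N) pos sh4).
  + by move=> v; have [_] := hD4 v; rewrite muln1.
  + by rewrite (fr4 1 isT) (fr3 1 isT) size_rcons /m2 !updateE /= addn1.
  + move=> i; rewrite size_rcons ltnS => ile.
    by rewrite (fr4 3 isT) (fr3 3 isT) vs2.
  + by rewrite (fr4 4 isT) (fr4 J isT) -src.
- by rewrite size_rcons; move: hB; move: (C * _) => k; lia.
move=> B'' m5 _ hB'' [fr5 [tr' -> hsum']].
rewrite size_rcons in hB''.
have {hB''}hB : C * (size us - j) + 40 <= B''.
  by move: hB hB''; move: (C * _) => k; lia.
apply: wp_put; [by move: hB => /=; move: (C * _) => k; lia | rewrite /=].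
exists j.+1, (tr ++ tr'); split=> //.
- split; first by rewrite updateE /= (fr5 J isT) (fr4 J isT) j3 addn1.
  apply: frame_update => //; apply: frame_trans fr3 _.
  by apply: (@frame_trans _ _ m4); [apply: frame_sub fr4 | apply: frame_sub fr5].
- split.
    split; first by rewrite updateE /= (fr5 PD isT); case: hev4.
    by move=> r; have [_ /(_ r)] := hev4; rewrite /= updateE /= (fr5 BH isT).
  by move=> v; rewrite !updateE /= !fr5 //; case: (hD4 v).
- split; first by rewrite flat_cat.
  rewrite (take_nth 0) ?size_rcons // ; exact: summarizes_rcons_source.
- by rewrite subSS; move: hB => /=; move: (C * _) => k; lia.
Qed.

End Site.

(** The three summands subtracted from 1 vanish exactly when, respectively, the bound is
    nonnegative, [t] was reached, and its distance is at most the bound. *)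
Definition decide_program : cmd :=
  (build (Get 6 (Lit 0)) (Get 5 (var J)) (Get 5 (Add (var J) (Lit 1)))
     (Get 5 (Add (var J) (Lit 2))) 3 ;;
   set_var NOW (Lit 1) ;;
   search (Get 0 (Lit 0)) ;;
   Send (Defs.Sub (Lit 1)
     (Add (Get 0 (Lit 2))
        (Add (Defs.Sub (var ST) (Get DI (Get 0 (Lit 1))))
             (Defs.Sub (Defs.Sub (Get DI (Get 0 (Lit 1))) (var ST))
                (Get 0 (Lit 3)))))))%cmd.

Lemma wp_decide (world : Type) post (w : world) (tr : seq triple) s t neg l m W
    (N : seq nat) (b : bool) :
  (forall a j, 10 <= a -> m a j = 0) ->
  m 0 0 = s -> m 0 1 = t -> m 0 2 = neg -> m 0 3 = l ->
  m 6 0 = size (flat tr) -> (forall j, m 5 j = nth 0 (flat tr) j) ->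
  (forall e, e \in tr -> e.2 <= W) ->
  (forall v, (v == s) || (v \in [seq e.1.2 | e <- tr]) -> v \in N) ->
  (b <-> neg = 0 /\ exists2 n, n <= l & walk tr s t n) ->
  wp post w decide_program (400 + 350 * size tr + 50 * (size N * W))
    (fun=> fun m' o' => o' = [:: nat_of_bool b]) m [::].
Proof.
move=> zero h00 h01 h02 h03 h6 h5 hW hN hb; rewrite /decide_program.
move: {2}(size N * W) (erefl (size N * W)) => NW eNW.
apply: wp_seq; apply: wp_call.
- apply: (@wp_build _ _ _ _ _ _ _ 3 tr) => //.
  + by move=> u; rewrite /= zero.
  + by move=> m' fr; rewrite /= (fr 6 isT) h6 size_flat.
  + move=> m' j fr jlt jE.
    by rewrite /= !(fr 5 isT) jE !h5 nth_flat // addn1 addn2.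
- by rewrite /=; lia.
move=> B m1 _ hB [-> hes fr1].
have {}hB : 370 + 200 * size tr + 50 * NW <= B by move: hB => /=; lia.
seq_assign; set m2 := update _ NOW 0 1.
have z2 a j : 10 <= a -> a \notin build_frame -> a != NOW -> m2 a j = 0.
  by move=> a10 ha aN; rewrite /m2 updateE (negPf aN) /= fr1 // zero.
apply: wp_seq; apply: wp_call.
- apply: (@wp_search _ _ _ _ m2 _ (rev tr) W N) => //.
  + by split=> [|r]; rewrite /= z2.
  + by move=> v; rewrite z2.
  + by move=> e; rewrite mem_rev; apply: hW.
  + rewrite /= /m2 updateE /= fr1 // h00 => v; rewrite map_rev mem_rev; exact: hN.
- by rewrite size_rev eNW /=; lia.
move=> B' m3 _ hB' [-> _ fr3 sh _].
have {}hB' : 40 <= B' by move: hB'; rewrite size_rev eNW /=; lia.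
apply: wp_send; first by rewrite /=; lia.
have m30 j : m3 0 j = m 0 j by rewrite fr3 // /m2 updateE /= fr1.
rewrite /= !m30 h01 h02 h03; congr [:: _].
move: sh; rewrite /= /m2 updateE /= fr1 // h00 => -[sh1 sh2].
have sub : {subset tr <= rev tr} by move=> e; rewrite mem_rev.
have sub' : {subset rev tr <= tr} by move=> e; rewrite mem_rev.
have -> : b = [&& neg == 0, m3 ST 0 <= m3 DI t & m3 DI t - m3 ST 0 <= l].
  apply/idP/and3P => [/hb[-> [n nl /(walk_sub sub)/sh2/andP[-> le]]]|[/eqP n0 le dl]].
    by split=> //; lia.
  apply/hb; split=> //; exists (m3 DI t - m3 ST 0) => //.
  by apply: walk_sub sub' _; apply: sh1.
case: neg {h02 hb} => [|neg] /=; last by rewrite subSS sub0n.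
rewrite add0n -[m3 ST 0 <= _]subn_eq0 -[_ - _ <= l]subn_eq0.
by case: (m3 ST 0 - _) => [|?]; case: (_ - l) => [|?].
Qed.

Variant dist_spec (T : finType) (e : rel T) (u v : T) : option nat -> Prop :=
| DistSome n of path_of_length e u v n &
    (forall m, path_of_length e u v m -> n <= m) : dist_spec e u v (Some n)
| DistNone of ~ connect e u v : dist_spec e u v None.

Lemma distP (T : finType) (e : rel T) u v : dist_spec e u v (dist e u v).
Proof.
(* [dist] matches on a proof indexed by [connect e u v]; abstracting both the boolean and the proof
   makes the case analysis well typed. *)
have gen (b : bool) (C : Prop) (r : reflect C b)
    (H : C -> exists n, path_of_length e u v n) : (connect e u v -> C) ->
    dist_spec e u v
      (match r with ReflectT c => Some (ex_minn (H c)) | ReflectF _ => None end).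
  case: r => [c _|nc hC]; last by constructor=> /hC.
  by case: ex_minnP => n; constructor.
exact: (gen _ _ (@idP _) (@connect_path_of_length T e u v)).
Qed.

(** * Distances in the graph *)

Section Graph.
Variables (Sigma : Type) (G : graph Sigma).
Implicit Types (u v : G).

Lemma path_of_lengthP u v n :
  reflect (exists p, [/\ path (@edge _ G) u p, last u p = v & size p = n])
    (path_of_length (@edge _ G) u v n).
Proof.
apply: (iffP existsP) => [[p /andP[hp /eqP hl]]|[p [hp hl /eqP hs]]].
  by exists p; rewrite size_tuple.
by exists (Tuple hs); rewrite hp hl eqxx.
Qed.

Lemma path_of_length_trans u v x n p :
  path_of_length (@edge _ G) u v n -> path_of_length (@edge _ G) v x p ->
  path_of_length (@edge _ G) u x (n + p).
Proof.
move=> /path_of_lengthP[a [ha la <-]] /path_of_lengthP[b [hb lb <-]].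
apply/path_of_lengthP; exists (a ++ b).
by rewrite cat_path last_cat size_cat ha la hb lb.
Qed.

Lemma dist_leP u v (l : int) :
  dist_le (dist (@edge _ G) u v) l <->
  nat_of_bool (l < 0)%R = 0 /\
  exists2 n, n <= absz l & path_of_length (@edge _ G) u v n.
Proof.
have le (n : nat) : ((Posz n <= l)%R : Prop) <->
    nat_of_bool (l < 0)%R = 0 /\ n <= absz l.
  by case: l => l /=; split; lia.
case: distP => [n hn hmin|nuv] /=.
  rewrite le; split=> [[-> ?]|[-> [p pl /hmin np]]].
    by split=> //; exists n.
  by split=> //; apply: leq_trans pl.
split=> // -[_ [n _ /path_of_lengthP[p [hp hl _]]]].
by case: nuv; apply/connectP; exists p.
Qed.

Lemma node_id_inj : injective (@node_id _ G).
Proof. by move=> u v /val_inj/enum_rank_inj. Qed.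

Lemma node_id_lt u : node_id u < #|G|.
Proof. exact: ltn_ord. Qed.

Lemma mem_ids (A : {set G}) u : (node_id u \in ids A) = (u \in A).
Proof. by rewrite mem_map ?mem_enum //; apply: node_id_inj. Qed.

Lemma size_ids (A : {set G}) : size (ids A) = #|A|.
Proof. by rewrite size_map -cardE. Qed.

Lemma idsP (A : {set G}) a : reflect (exists2 u, u \in A & a = node_id u) (a \in ids A).
Proof.
by apply: (iffP mapP) => -[u]; rewrite ?mem_enum => hu ->; exists u; rewrite ?mem_enum.
Qed.

(** Used twice for soundness: for the unit edges of a fragment, and for the reported triples, whose
    weights are lengths of paths. *)
Lemma walk_path es u b n :
  (forall v c a, (node_id v, a, c) \in es ->
     exists2 x, a = node_id x & path_of_length (@edge _ G) v x c) ->
  walk es (node_id u) b n ->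
  exists2 v, b = node_id v & path_of_length (@edge _ G) u v n.
Proof.
move=> hes; elim=> [|v x c p _ [y -> hy] /hes[z -> hz]].
  by exists u => //; apply/path_of_lengthP; exists [::].
by exists z => //; apply: path_of_length_trans hz.
Qed.

Variables (k : nat) (F : fragmentation G k).

Lemma part_cover v : exists i, v \in F i.
Proof.
have /and3P[/eqP cov _ _] := part_partition F.
have : v \in cover [set part F i | i : 'I_k] by rewrite cov inE.
by case/bigcupP => A /imsetP[i _ ->]; exists i.
Qed.

Lemma part_disjoint v i j : v \in F i -> v \in F j -> i = j.
Proof.
move=> vi vj; have /and3P[_ triv _] := part_partition F.
apply: (@part_inj _ _ _ F).
by rewrite -(def_pblock triv _ vi) ?(def_pblock triv _ vj) //; apply: imset_f.
Qed.

(** The target of an edge leaving a node of [F i] lies in [F i] or is a virtual node by virtue of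
    this very edge. *)
Lemma mem_frag_edges i e : (e \in frag_edges F i) = edge e.1 e.2 && (e.1 \in F i).
Proof.
rewrite !inE; case: (boolP (edge e.1 e.2)) => //= ev.
case: (boolP (e.1 \in F i)) => //= ei.
case: (e.2 \in F i) => //=; apply/exists_inP; by exists e.1.
Qed.

Definition frag_pairs i : seq (nat * nat) :=
  [seq (node_id e.1, node_id e.2) | e <- enum (frag_edges F i)].

(** Reversed because [build] inserts each edge in front of the earlier ones. *)
Definition frag_triples i : seq triple :=
  rev [seq (e.1, e.2, 1) | e <- frag_pairs i].

Lemma frag_triplesP i a b c :
  (a, b, c) \in frag_triples i <->
  exists u v, [/\ a = node_id u, b = node_id v, c = 1, edge u v & u \in F i].
Proof.
rewrite mem_rev; split=> [/mapP[[a' b'] /mapP[[u v]]]|[u [v [-> -> -> uv ui]]]].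
  by rewrite mem_enum mem_frag_edges /= => /andP[? ?] [-> ->] [-> -> ->]; exists u, v.
rewrite -map_comp; apply/mapP; exists (u, v) => //.
by rewrite mem_enum mem_frag_edges uv.
Qed.

Lemma walk_frag_path i u b n :
  walk (frag_triples i) (node_id u) b n ->
  exists2 v, b = node_id v & path_of_length (@edge _ G) u v n.
Proof.
apply: walk_path => v c a /frag_triplesP[x [y [/node_id_inj-> -> -> xy _]]].
by exists y => //; apply/path_of_lengthP; exists [:: y]; rewrite /= xy.
Qed.

Variables (s t : G) (N : 'I_k -> nat) (tr : 'I_k -> seq triple).
Hypothesis tr_summary : forall i, summarizes (frag_triples i) (N i)
  (rcons (ids (in_nodes F i)) (node_id s))
  (rcons (ids (virtual_nodes F i)) (node_id t)) (tr i).

Let all_triples := flatten [seq tr i | i <- enum 'I_k].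

Lemma mem_all_triples e : e \in all_triples <-> exists i, e \in tr i.
Proof.
split=> [/flattenP[r /mapP[i _ ->] he]|[i he]]; first by exists i.
by apply/flattenP; exists (tr i) => //; apply: map_f; rewrite mem_enum.
Qed.

(* A path is followed through one fragment at a time: [u] is where it entered the
   fragment [F i], and [v] is the current node. *)
Lemma report_complete u i v m p :
  u \in F i -> (u \in in_nodes F i) || (u == s) -> v \in F i ->
  walk (frag_triples i) (node_id u) (node_id v) m ->
  path (@edge _ G) v p -> last v p = t ->
  exists2 n, n <= m + size p & walk all_triples (node_id u) (node_id t) n.
Proof.
have src x j : (x \in in_nodes F j) || (x == s) ->
    node_id x \in rcons (ids (in_nodes F j)) (node_id s).
  by rewrite mem_rcons inE (inj_eq node_id_inj) mem_ids orbC.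
elim: p u i v m => [|x p IH] u i v m ui us vi w /=.
  move=> _ vt; have [_ complete _] := tr_summary i.
  have [|e|[d dm hd]] := complete _ _ _ (src _ _ us) _ w.
  - by rewrite vt mem_rcons mem_head.
  (* Distance 0 is not reported; the empty walk takes its place. *)
  - by rewrite -vt e; exists 0 => //; apply: walk_nil.
  - rewrite addn0; exists d => //; rewrite -vt -[d]add0n.
    by apply: walk_rcons (walk_nil _ _) _; apply/mem_all_triples; exists i.
case/andP => vx xp xt.
have wx : walk (frag_triples i) (node_id u) (node_id x) (m + 1).
  by apply: walk_rcons w _; apply/frag_triplesP; exists v, x.
case: (boolP (x \in F i)) => xi.
  have [n nle wn] := IH u i x _ ui us xi wx xp xt.
  by exists n; rewrite // addnS -addSn -addn1.
have [j xj] := part_cover x.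
have xin : x \in in_nodes F j.
  rewrite inE xj; apply/existsP; exists i.
  rewrite (contraNneq _ xi) => [|->//] /=; apply/exists_inP; by exists v.
have xvirt : node_id x \in rcons (ids (virtual_nodes F i)) (node_id t).
  rewrite mem_rcons inE mem_ids inE xi; apply/orP; right.
  by apply/exists_inP; exists v.
(* The path is cut at [x], a virtual node of [F i] and an in-node of [F j]; the rest is followed
   from [x] with an empty local walk. *)
have [n nle wn] := IH x j x 0 xj (introT orP (or_introl xin)) xj (walk_nil _ _) xp xt.
have [_ complete _] := tr_summary i.
have [e|[d dm hd]] := complete _ _ _ (src _ _ us) xvirt wx.
  by move: ui xi; rewrite (node_id_inj e) => ->.
exists (d + n); first by lia.
apply: walk_trans wn; rewrite -[d]add0n.
by apply: walk_rcons (walk_nil _ _) _; apply/mem_all_triples; exists i.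
Qed.

(** A path is cut into reported pieces by [report_complete]; conversely each triple stands for a
    path of the same length inside one fragment. *)
Lemma report_walkP (l : int) :
  dist_le (dist (@edge _ G) s t) l <->
  nat_of_bool (l < 0)%R = 0 /\
  exists2 n, n <= absz l & walk all_triples (node_id s) (node_id t) n.
Proof.
rewrite dist_leP; split=> -[-> [n nl hn]]; split=> //.
  have /path_of_lengthP[p [hp hl sp]] := hn.
  have [i si] := part_cover s.
  have [|d dn wd] := report_complete si _ si (walk_nil _ _) hp hl.
    by rewrite eqxx orbT.
  by exists d => //; apply: leq_trans dn _; rewrite sp.
have [|v /node_id_inj-> pv] := walk_path _ hn; last by exists n.
move=> v c a /mem_all_triples[i] /(summary_sound (tr_summary i))[_ _ _].
exact: walk_frag_path.
Qed.

End Graph.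

(** * Traffic and time *)

Lemma flat_flatten (ss : seq (seq triple)) :
  flat (flatten ss) = flatten [seq flat x | x <- ss].
Proof. by elim: ss => //= x ss IH; rewrite flat_cat IH. Qed.

Section Bounds.
Variables (Sigma : Type) (G : graph Sigma) (k : nat) (F : fragmentation G k).
Variables (s t : G) (l : int).

(** Double counting: the fragments are disjoint, so each node of [B] lies in at most one [A i]. *)
Lemma sum_part_card (A : 'I_k -> {set G}) (B : {set G}) :
  (forall i, A i \subset F i :&: B) -> \sum_(i < k) #|A i| <= #|B|.
Proof.
move=> sub; have AB i v : v \in A i -> v \in B.
  by move/(subsetP (sub i)); rewrite inE => /andP[].
have AF i v : v \in A i -> v \in F i.
  by move/(subsetP (sub i)); rewrite inE => /andP[].
rewrite (eq_bigr (fun i => \sum_(v in B) (v \in A i : nat))); last first.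
  move=> i _; rewrite -sum1_card [RHS]big_mkcond [LHS]big_mkcond /=.
  apply: eq_bigr => v _; case: (boolP (v \in A i)) => [/AB->//|_]; by case: ifP.
rewrite exchange_big -sum1_card /=; apply: leq_sum => v _.
case: (pickP (fun i => v \in A i)) => [i vi|none]; last first.
  by rewrite big1 // => i _; rewrite none.
rewrite (bigD1 i) //= vi big1 // => j ji.
apply/eqP; rewrite eqb0; apply: contraNN ji => /AF vj.
by rewrite (part_disjoint vj (AF _ _ vi)).
Qed.

Lemma in_nodes_sub i : in_nodes F i \subset F i :&: Vf F.
Proof.
apply/subsetP => v vi; rewrite inE; apply/andP; split.
  by move: vi; rewrite inE => /andP[].
by apply/bigcupP; exists i => //; rewrite inE vi orbT.
Qed.

Lemma virtual_nodes_sub i : virtual_nodes F i \subset Vf F.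
Proof. by apply/subsetP => v vi; apply/bigcupP; exists i => //; rewrite inE vi. Qed.

Lemma leq_max_frag_size i : frag_size F i <= max_frag_size F.
Proof. exact: leq_bigmax. Qed.

Lemma max_frag_size_gt0 : 0 < max_frag_size F.
Proof.
have [i si] := part_cover F s; apply: leq_trans (leq_max_frag_size i).
by rewrite addn_gt0; apply/orP; left; apply/card_gt0P; exists s; rewrite inE si.
Qed.

Lemma card_virtual_nodes i : #|virtual_nodes F i| <= max_frag_size F.
Proof.
apply: leq_trans (leq_max_frag_size i); apply: leq_trans (leq_addr _ _).
by apply: subset_leq_card; apply: subsetUr.
Qed.

(** With unit weights, distances are bounded by the number of nodes that a local search can settle;
    [s] is added because it is a source even outside the fragment. *)
Definition frag_summary i :=
  summarizes (frag_triples F i) #|s |: frag_nodes F i|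
    (rcons (ids (in_nodes F i)) (node_id s))
    (rcons (ids (virtual_nodes F i)) (node_id t)).

(** Edges stored at a site start in its own part, so the extra source [s] contributes only to the
    fragment that contains it. The extra target [t] accounts for [M.+1]. *)
Lemma frag_summary_size i tr M :
  #|virtual_nodes F i| <= M -> frag_summary i tr ->
  size tr <= (#|in_nodes F i| + #|[set s] :&: F i|) * M.+1.
Proof.
move=> hM [_ _ /leq_trans]; apply.
rewrite size_rcons size_ids; apply: leq_mul; last by [].
rewrite -cats1 count_cat /=; apply: leq_add.
  by apply: leq_trans (count_size _ _) _; rewrite size_ids.
rewrite addn0; case: hasP => // -[[[a b] c]] he /= /eqP ea.
have /frag_triplesP[u [v [eu _ _ _ ui]]] := he.
apply/card_gt0P; exists s; rewrite !inE eqxx.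
by rewrite (node_id_inj (etrans (esym ea) eu)).
Qed.

Lemma total_summary_size (tr : 'I_k -> seq triple) M :
  (forall i, #|virtual_nodes F i| <= M) -> (forall i, frag_summary i (tr i)) ->
  \sum_(i < k) size (tr i) <= #|Vf F|.+1 * M.+1.
Proof.
move=> hM htr.
apply: leq_trans (leq_sum _ (fun i _ => frag_summary_size (hM i) (htr i))) _.
rewrite -big_distrl leq_mul2r /= big_split /= -addn1; apply: leq_add.
  exact: sum_part_card in_nodes_sub.
rewrite -(cards1 s); apply: sum_part_card => i; by rewrite setIC.
Qed.

Lemma site_visit A i : site_prog A = site_program ->
  exists tr x', [/\ visit A s t l (initial_sites F i) (flat tr) x',
    frag_summary i tr, site_visits x' = 1, site_shipped x' = flat tr &
    site_time x' <= 200 + 150 * #|frag_edges F i| +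
      #|in_nodes F i|.+1 * (500 + 200 * #|frag_edges F i| +
        50 * #|s |: frag_nodes F i| + 80 * #|virtual_nodes F i|)].
Proof.
move=> hA.
have szE : size (frag_pairs F i) = #|frag_edges F i| by rewrite size_map -cardE.
have [|||||||||||] // := @wp_site _ (fun _ _ _ _ => False) tt
  (ids (in_nodes F i)) (ids (virtual_nodes F i)) (frag_pairs F i)
  (node_id s) (node_id t) (load (site_data F i) 0 (query_data s t l))
  (ids (s |: frag_nodes F i)).
- by do 10 case=> // ; move=> b j _; rewrite /load /= /site_data /memory_of /= nth_nil.
- by rewrite size_ids.
- by rewrite size_ids.
- by move=> j; rewrite /unzip1 -map_comp.
- by move=> j; rewrite /unzip2 -map_comp.
- move=> v; rewrite mem_cat mem_rcons inE -orbA => /or3P[/eqP->|/idsP[u ui ->]|].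
  + by rewrite mem_ids setU11.
  + by move: ui; rewrite mem_ids !inE => /andP[-> _]; rewrite orbT.
  + rewrite /unzip2 -map_comp => /mapP[[u v']]; rewrite mem_enum mem_frag_edges /=.
    move=> /andP[uv ui] ->; rewrite mem_ids !inE.
    case: (v' \in F i); rewrite ?orbT //=; apply/orP; right.
    by apply/exists_inP; exists u.
move=> T [m' [o' [hex hT [tr ho hsum]]]].
rewrite !size_ids szE in hT hsum.
exists tr, (SiteState m' T 1 (flat tr)); split=> //.
exists T, (Config m' (flat tr) tt); split=> //.
- by rewrite hA -ho.
(* Every shipped number fits in a word: names are below [#|G|], and distances are at most the size
   of a set of nodes. *)
- apply/allP => n /flattenP[r /mapP[[[u v] d] he ->]].
  have [hu hv /andP[_ hd] _] := summary_sound hsum he.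
  have lt x (y : G) A' : x \in rcons (ids (A' : {set G})) (node_id y) -> x <= #|G|.
    by rewrite mem_rcons inE => /orP[/eqP->|/idsP[z _ ->]]; rewrite ltnW ?node_id_lt.
  rewrite !inE => /or3P[] /eqP-> /=; [exact: lt hu | exact: lt hv|].
  exact: leq_trans hd (max_card _).
Qed.

End Bounds.

(** * The resource bounds of the whole algorithm *)

Theorem theorem2 :
  exists (A : algorithm) (c : nat),
    forall (Sigma : Type) (G : graph Sigma) (k : nat) (F : fragmentation G k)
           (s t : G) (l : int),
      exists R : outcome k,
        terminates_with F A s t l R /\
        [/\ answer R = [:: nat_of_bool (dist_le (dist (@edge Sigma G) s t) l)],
            response_time R <= c * (maxn 1 #|Vf F| * max_frag_size F),
            forall i : 'I_k, visits R i = 1 &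
            traffic R <= c * maxn 1 #|Vf F| ^ 2].
Proof.
pose A := Algorithm site_program (Seq Post decide_program).
(* In units of [V * M], the sites need at most 2110 and the coordinator 400 + 350 * 4 + 50 * 6 =
   2100. The traffic needs only the constant 12. *)
exists A, 4210 => Sigma G k F s t l.
have [tr htr] := fin_all_exists (fun i => site_visit F s t l i (erefl (site_prog A))).
have {htr}[w' htr] := fin_all_exists htr.
have hsum i : frag_summary F s t i (tr i) by case: (htr i).
set msg := fun i => flat (tr i).
set all_tr := flatten [seq tr i | i <- enum 'I_k].
have flatE : flatten [seq msg i | i <- enum 'I_k] = flat all_tr.
  by rewrite flat_flatten -map_comp.
have size_all : size all_tr = \sum_(i < k) size (tr i).
  by rewrite size_flatten /shape -map_comp sumnE big_map big_enum.
set V := maxn 1 #|Vf F|; set M := max_frag_size F.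
have M0 : 0 < M := max_frag_size_gt0 F s.
have V0 : 0 < V by rewrite leq_max.
have VfV : #|Vf F| <= V by rewrite leq_maxr.
have virtV i : #|virtual_nodes F i| <= #|Vf F|.
  by apply: subset_leq_card (virtual_nodes_sub F i).
have nodesM i : #|s |: frag_nodes F i| <= M.+1.
  rewrite cardsU1 -add1n; apply: leq_add; first by case: (_ \notin _).
  by apply: leq_trans (leq_max_frag_size F i); apply: leq_addr.
set m := receive (coordinator_data F s t l) msg.
(* The nodes that the coordinator's search can settle: [s], and the targets of triples, which are
   virtual nodes or [t]. *)
pose N := node_id s :: node_id t :: ids (Vf F).
have [||||||||||] // := @wp_decide _ (post_query A s t l) w' all_tr
  (node_id s) (node_id t) (nat_of_bool (l < 0)%R) (absz l) m M.+1 N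
  (dist_le (dist (@edge Sigma G) s t) l).
- do 10 case=> //; move=> a j _.
  by rewrite /m /receive /load /= /coordinator_data /memory_of /= nth_nil.
- by rewrite /m /receive /load /= flatE.
- by move=> j; rewrite /m /receive /load /= flatE.
- move=> [[u v] d] /flattenP[r /mapP[i _ ->]].
  move=> /(summary_sound (hsum i))[_ _ /andP[_ hd] _].
  exact: leq_trans hd (nodesM i).
- move=> v /orP[/eqP->|]; first exact: mem_head.
  case/mapP=> -[[u x] d] /flattenP[r /mapP[i _ ->]].
  move=> /(summary_sound (hsum i))[_ hx _ _] -> /=.
  move: hx; rewrite mem_rcons !inE => /orP[->|]; first by rewrite orbT.
  move=> /idsP[y hy ->]; rewrite mem_ids (subsetP (virtual_nodes_sub F i)) ?orbT //.
- exact: report_walkP hsum l.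
move=> T [m' [o' [hex hT ho]]].
exists (Outcome o' T w'); split.
  exists m'; rewrite /= -[T]add0n; apply: ExecSeq hex; apply: ExecPost.
  by exists msg; split=> // i; case: (htr i).
split=> //=.
- have small : size all_tr <= 4 * (V * M).
    rewrite size_all; apply: leq_trans (total_summary_size (card_virtual_nodes F) hsum) _.
    have -> : 4 * (V * M) = (2 * V) * (2 * M) by rewrite mulnACA.
    by apply: leq_mul; lia.
  have NM : size N * M.+1 <= 6 * (V * M).
    have -> : 6 * (V * M) = (3 * V) * (2 * M) by rewrite mulnACA.
    by apply: leq_mul; rewrite /= ?size_ids; lia.
  have VM0 : 0 < V * M by rewrite muln_gt0 V0.
  have MVM : M <= V * M by apply: leq_pmull.
  have sites_le : \max_(i < k) site_time (w' i) <= 2110 * (V * M).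
    apply/bigmax_leqP => i _; have [_ _ _ _ hti] := htr i; apply: leq_trans hti _.
    have inV : #|in_nodes F i|.+1 <= 2 * V.
      have : #|in_nodes F i| <= #|Vf F|.
        by apply: subset_leq_card; apply: subset_trans (in_nodes_sub F i) (subsetIr _ _).
      by lia.
    have EM : #|frag_edges F i| <= M.
      by apply: leq_trans (leq_max_frag_size F i); apply: leq_addl.
    have OM := card_virtual_nodes F i; have NiM := nodesM i.
    have : #|in_nodes F i|.+1 * (500 + 200 * #|frag_edges F i| +
        50 * #|s |: frag_nodes F i| + 80 * #|virtual_nodes F i|) <= (2 * V) * (880 * M).
      by apply: leq_mul => //; rewrite -/M in OM; lia.
    rewrite mulnACA; lia.
  rewrite /response_time /=; apply: leq_trans (leq_add sites_le hT) _.
  by lia.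
- by move=> i; case: (htr i).
(* Each triple ships three numbers, and here the virtual nodes of a fragment are bounded by
   [#|Vf F|]. *)
- rewrite /traffic /=; under eq_bigr => i _.
    have [_ _ _ -> _] := htr i; rewrite size_flat; over.
  rewrite -big_distrr /=.
  have := total_summary_size virtV hsum => h.
  have : \sum_(i < k) size (tr i) <= 4 * V ^ 2.
    apply: leq_trans h _; have -> : 4 * V ^ 2 = (2 * V) * (2 * V) by rewrite mulnACA.
    by apply: leq_mul; lia.
  move=> {}h; apply: leq_trans (leq_mul (leqnn 3) h) _; by rewrite mulnA leq_mul2r orbT.
Qed.
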